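(* Consider the sparse principal component detection problem with $\mathcal{C}=\{\mathcal{S}\subseteq[d]:|\mathcal{S}|=s^*\}$. Let $s^*=d^{1/8}$ and let $T\ge1$ with $T=O(d^{\eta})$, where $\eta$ is any constant. If $$\beta^*\sqrt{\frac{n}{s^{*2}\log(1/\xi)}}=o(1),$$ then $$\frac{T\cdot\sup_{q\in\mathcal{Q}}|\mathcal{C}(q)|}{|\mathcal{C}|}=o(1).$$
   Context: Setting: $\mathbb{P}_0=N(\mathbf{0},\mathbf{I}_d)$; for $\mathcal{S}\in\mathcal{C}$, $\mathbb{P}_{\mathcal{S}}=N(\mathbf{0},\mathbf{I}_d+\beta^*\mathbf{v}_{\mathcal{S}}\mathbf{v}_{\mathcal{S}}^{\top})$, where $\beta^*>0$, $(\mathbf{v}_{\mathcal{S}})_j=1/\sqrt{s^*}$ for $j\in\mathcal{S}$ and $0$ otherwise. Asymptotics: $s^*,n,\beta^*,\xi,T$ are sequences indexed by $d\to\infty$ with $n\to\infty$, $\beta^*=o(1)$, $\xi\in[0,1/4)$ (with $\log(1/0)=+\infty$); limits of all sequences considered are assumed to exist. Queries: fix $b>0$; $\mathcal{Q}$ is the set of all (measurable) functions $q:\mathbb{R}^d\to[-b,b]$. For $q\in\mathcal{Q}$, $\mathcal{C}(q)=\{\mathcal{S}\in\mathcal{C}: |\mathbb{E}_{\mathbb{P}_{\mathcal{S}}}[q(\boldsymbol{X})]-\mathbb{E}_{\mathbb{P}_0}[q(\boldsymbol{X})]|>\overline{\tau}_q\}$, where $\overline{\tau}_q=\max\{\frac{2b}{3}\cdot\frac{\log(1/\xi)}{n},\sqrt{2\,\mathrm{Var}_{\mathbb{P}_0}[q(\boldsymbol{X})]\log(1/\xi)/n}\}$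 ($+\infty$ if $\xi=0$). *)

(* Defs.v *)
From HB Require Import structures.
From mathcomp Require Import all_boot all_order all_algebra.
From mathcomp Require Import all_classical all_reals all_analysis.

Set Implicit Arguments.
Unset Strict Implicit.
Unset Printing Implicit Defensive.

Import Order.TTheory GRing.Theory Num.Theory.
Import numFieldNormedType.Exports.

Local Open Scope classical_set_scope.
Local Open Scope ring_scope.

(* The Borel space R^d: tuples with the sigma-algebra generated by the
   coordinate projections. *)
Notation euclid R d := (d.-tuple (measurableTypeR R)).

Section lebesgue_euclid.
Context {R : realType}.

Definition consR d (p : measurableTypeR R * euclid R d) : euclid R d.+1 :=
  [the euclid R d.+1 of p.1 :: p.2].

Lemma measurable_consR d : measurable_fun setT (@consR d).
Proof. exact: measurable_cons. Qed.

Section step.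
Variables (d : nat) (m : {sigma_finite_measure set (euclid R d) -> \bar R}).

Definition lebesgue_consR : set (euclid R d.+1) -> \bar R :=
  pushforward (@lebesgue_measure R \x m)%E (@consR d).

(* Given by name because unification cannot recover the measurability proof
   carried by the instance on [pushforward]. *)
Let m_consR : {measure set (euclid R d.+1) -> \bar R} :=
  measure_function_pushforward__canonical__measure_function_Measure
    (@lebesgue_measure R \x m)%E (@measurable_consR d).

Let lebesgue_consR0 : lebesgue_consR set0 = 0%E.
Proof. exact: (measure0 m_consR). Qed.

Let lebesgue_consR_ge0 A : (0 <= lebesgue_consR A)%E.
Proof. exact: (measure_ge0 m_consR). Qed.

Let lebesgue_consR_sigma_additive : semi_sigma_additive lebesgue_consR.
Proof. exact: (@measure_semi_sigma_additive _ _ _ m_consR). Qed.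

HB.instance Definition _ := isMeasure.Build _ _ _ lebesgue_consR
  lebesgue_consR0 lebesgue_consR_ge0 lebesgue_consR_sigma_additive.

Let lebesgue_consR_sigma_finite : sigma_finite setT lebesgue_consR.
Proof.
have /sigma_finiteP[F [TF ndF Foo]] := sigma_finiteT (@lebesgue_measure R).
have /sigma_finiteP[G [TG ndG Goo]] := sigma_finiteT m.
pose g (t : euclid R d.+1) : measurableTypeR R * euclid R d :=
  (thead t, [tuple of behead t]).
have mg : measurable_fun setT g.
  apply/measurable_fun_pairP; split => /=.
    exact: (measurable_tnth ord0).
  exact: measurable_behead.
have gK p : g (consR p) = p.
  by case: p => x t; congr pair; rewrite ?theadE//; exact/val_inj.
exists (fun n => g @^-1` (F n `*` G n)).
  rewrite -preimage_bigcup (_ : \bigcup_n _ = setT) ?preimage_setT//.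
  apply/seteqP; split => // -[x y] _.
  have [i _ Fx] : (\bigcup_i F i) x by rewrite -TF.
  have [j _ Gy] : (\bigcup_j G j) y by rewrite -TG.
  exists (maxn i j) => //; split.
    by move: x Fx; exact/subsetPset/ndF/leq_maxl.
  by move: y Gy; exact/subsetPset/ndG/leq_maxr.
move=> n; have [mF Fn] := Foo n; have [mG Gn] := Goo n; split.
  by rewrite -[X in measurable X]setTI; apply: mg => //; exact: measurableX.
rewrite /lebesgue_consR /pushforward.
suff -> : @consR d @^-1` (g @^-1` (F n `*` G n)) = F n `*` G n.
  by rewrite product_measure1E// lte_mul_pinfty// ge0_fin_numE.
by rewrite -comp_preimage (_ : g \o _ = id)//; exact/funext.
Qed.

HB.instance Definition _ :=
  Measure_isSigmaFinite.Build _ _ _ lebesgue_consR lebesgue_consR_sigma_finite.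

End step.

Fixpoint lebesgue_euclid (d : nat) :
    {sigma_finite_measure set (euclid R d) -> \bar R} :=
  match d with
  | 0%N => \d_([tuple])
  | d'.+1 => lebesgue_consR (lebesgue_euclid d')
  end.

End lebesgue_euclid.
Arguments lebesgue_euclid : clear implicits.

Section gaussian.
Context {R : realType} {d : nat}.

Definition rowv (x : euclid R d) : 'rV[R]_d := \row_j tnth x j.

(* Meaningful for a symmetric positive definite covariance matrix [V]. *)
Definition gaussian_pdf (m : 'rV[R]_d) (V : 'M[R]_d) (x : euclid R d) : R :=
  let y := rowv x - m in
  (Num.sqrt ((2 * pi) ^+ d * \det V))^-1 *
  expR (- (y *m invmx V *m y^T) 0 0 / 2).

Definition is_gaussian (m : 'rV[R]_d) (V : 'M[R]_d)
    (P : probability (euclid R d) R) : Prop :=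
  forall A, measurable A ->
    P A = (\int[lebesgue_euclid R d]_(x in A) (gaussian_pdf m V x)%:E)%E.

End gaussian.

Section sparse_pca.
Context {R : realType}.

Definition candidates (d s : nat) : {set {set 'I_d}} :=
  [set S : {set 'I_d} | #|S| == s]%SET.

Definition spike d (s : nat) (S : {set 'I_d}) : 'cV[R]_d :=
  \col_j (if j \in S then (Num.sqrt s%:R)^-1 else 0).

Definition spiked_cov d (s : nat) (beta : R) (S : {set 'I_d}) : 'M[R]_d :=
  1%:M + beta *: (spike s S *m (spike s S)^T).

Definition queries d (b : R) : set (euclid R d -> R) :=
  [set q | measurable_fun setT q /\ forall x, - b <= q x <= b].

(* [log (1 / xi)], with value [+oo] at [xi = 0]: in [\bar R], [0^-1 = +oo] and
   [lne +oo = +oo]. *)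
Definition log_inv (xi : R) : \bar R := lne (xi%:E^-1)%E.

(* For [b, n > 0] and [xi = 0] the first term is [+oo], hence so is the maximum,
   even if the variance vanishes (in which case the second term is [0]). *)
Definition tolerance d (b : R) (n : nat) (xi : R)
    (P0 : probability (euclid R d) R) (q : euclid R d -> R) : \bar R :=
  (maxe ((2 * b / 3)%:E * (log_inv xi / (n%:R)%:E))
        (sqrte (2%:E * 'V_P0[q] * log_inv xi / (n%:R)%:E)))%E.

Definition detected d (s : nat) (b : R) (n : nat) (xi : R)
    (P0 : probability (euclid R d) R)
    (PS : {set 'I_d} -> probability (euclid R d) R)
    (q : euclid R d -> R) : {set {set 'I_d}} :=
  [set S in candidates d s |
     (tolerance b n xi P0 q < `| 'E_(PS S)[q] - 'E_P0[q] |)%E]%SET.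

End sparse_pca.
Arguments queries {R} d b.

(* Main.v *)
Require Import Defs.
From HB Require Import structures.
From mathcomp Require Import all_boot all_order all_algebra.
From mathcomp Require Import all_classical all_reals all_analysis.
From mathcomp Require Import measurable_realfun zify ring lra.
Import Order.TTheory GRing.Theory Num.Theory.
Import numFieldNormedType.Exports.
Local Open Scope classical_set_scope.
Local Open Scope ring_scope.

(* A second-moment argument. Let [L_S] be the density of P_S with respect to
   P_0. Then E_S[q] - E_0[q] = Cov_0(q, L_S), so if [D] is the set detected by
   [q], Cauchy-Schwarz applied to [q] and to the sum over [S \in D] of the
   [L_S], signed so that all the covariances with [q] are positive, gives
     |D|^2 * 2 log(1/xi) / n <= sum_(S, S' in D) |Cov_0(L_S, L_S')|,
   the variance of [q] cancelling. For Gaussian spikes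
     Cov_0(L_S, L_S') = (1 - (beta |S :&: S'| / s)^2)^(-1/2) - 1,
   which is at most (beta |S :&: S'| / s)^2 when beta <= 1/2. At most a fraction
   (s^2 / d)^k of the candidates meets a given [S] in [k] points or more, so the
   sum of |S :&: S'|^2 over [D] x [D] is at most
     k^2 |D|^2 + |D| s^2 (s^2 / d)^k |C|.
   Since 2 s^2 log(1/xi) / (n beta^2) eventually exceeds k^2 + 1, this forces
   |D| <= s^2 (s^2 / d)^k |C|; with s = d^(1/8) and [k] large this beats any
   polynomial T. *)

(** * Integration of densities on R^d *)

Section density.
Context d (T : measurableType d) (R : realType).
Variables (mu : {sigma_finite_measure set T -> \bar R}) (nu : probability T R).
Variable f : T -> R.
Hypotheses (mf : measurable_fun setT f) (f0 : forall x, 0 <= f x).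
Hypothesis nuE : forall A, measurable A ->
  nu A = (\int[mu]_(x in A) (f x)%:E)%E.

(** By uniqueness of densities, [f] is [mu]-almost everywhere the Radon-Nikodym derivative of [nu],
    whose change of variables formula then transfers to [f]. *)
Lemma ge0_integral_density (g : T -> \bar R) :
  measurable_fun setT g -> (forall x, 0 <= g x)%E ->
  (\int[nu]_x g x = \int[mu]_x (g x * (f x)%:E))%E.
Proof.
move=> mg g0.
have mfE : measurable_fun setT (EFin \o f) by exact/measurable_EFinP.
have numu : nu `<< mu.
  apply/null_content_dominatesP => A mA muA0; rewrite nuE//.
  by apply: null_set_integral => //; exact: measurable_funTS.
rewrite -(Radon_Nikodym_SigmaFinite.change_of_variables numu)//.
apply: ge0_ae_eq_integral => //.
- apply: emeasurable_funM => //.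
  exact: measurable_int (Radon_Nikodym_SigmaFinite.f_integrable numu).
- exact: emeasurable_funM.
- by move=> x _; rewrite mule_ge0// Radon_Nikodym_SigmaFinite.f_ge0.
- by move=> x _; rewrite mule_ge0// lee_fin.
suff : ae_eq mu setT (Radon_Nikodym_SigmaFinite.f nu mu) (EFin \o f).
  by apply: filterS => x /= + Tx => ->.
apply: integral_ae_eq => //.
  exact: Radon_Nikodym_SigmaFinite.f_integrable.
move=> E _ mE; rewrite -(Radon_Nikodym_SigmaFinite.f_integral numu mE).
exact: nuE.
Qed.

End density.

(** * Tonelli's theorem for Lebesgue measure on R^d *)

Section lebesgue_euclid_product.
Context {R : realType}.

Lemma measurable_comp_tnth d (g : R -> R) (j : 'I_d) :
  measurable_fun setT g -> measurable_fun setT (fun x : euclid R d => g (tnth x j)).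
Proof. move=> mg; exact: (measurableT_comp mg (measurable_tnth j)). Qed.

Lemma ge0_integral_lebesgue_euclidS d (f : euclid R d.+1 -> \bar R) :
  measurable_fun setT f -> (forall x, 0 <= f x)%E ->
  (\int[lebesgue_euclid R d.+1]_x f x =
   \int[@lebesgue_measure R]_u
     \int[lebesgue_euclid R d]_t f (consR (u, t)))%E.
Proof.
move=> mf f0.
have mc := @measurable_consR R d.
rewrite (@ge0_integral_pushforward _ _ _ _ _ _ mc
  (lebesgue_measure \x lebesgue_euclid R d)%E)//=.
rewrite preimage_setT (fubini_tonelli1 (f \o (@consR R d)))//.
  exact: measurableT_comp.
by move=> x; exact: f0.
Qed.

(** The induction peels off the first coordinate. In dimension 0 the measure is a Dirac mass and
    both sides are an empty product. *)
Lemma ge0_integral_prod_lebesgue_euclid d (F : 'I_d -> R -> R) (c : 'I_d -> R) :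
  (forall j, measurable_fun setT (F j)) -> (forall j t, 0 <= F j t) ->
  (forall j, \int[@lebesgue_measure R]_t (F j t)%:E = (c j)%:E)%E ->
  (\int[lebesgue_euclid R d]_x (\prod_(j < d) F j (tnth x j))%:E =
   (\prod_(j < d) c j)%:E)%E.
Proof.
elim: d F c => [|d IH] F c mF F0 Fc.
  under eq_integral do rewrite big_ord0.
  by rewrite big_ord0 /= integral_dirac//= diracT mul1e.
rewrite ge0_integral_lebesgue_euclidS; last 2 first.
- apply/measurable_EFinP; apply: measurable_prod => j _.
  exact: measurable_comp_tnth.
- by move=> x; rewrite lee_fin prodr_ge0.
under eq_integral => u _.
  under eq_integral => t _.
    rewrite big_ord_recl /= (tnth0 u t).
    under eq_bigr => j _ do rewrite tnthS.
    rewrite EFinM; over.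
  rewrite ge0_integralZl//; last 3 first.
  - apply/measurable_EFinP; apply: measurable_prod => j _.
    exact: measurable_comp_tnth.
  - by move=> t _; rewrite lee_fin prodr_ge0.
  - by rewrite lee_fin.
  rewrite (IH (fun j => F (lift ord0 j)) (fun j => c (lift ord0 j)))//.
  over.
rewrite ge0_integralZr//=; last 3 first.
- by apply/measurable_EFinP; exact: mF.
- by move=> t _; rewrite lee_fin.
- rewrite lee_fin prodr_ge0// => j _; rewrite -lee_fin -Fc.
  by rewrite integral_ge0// => t _; rewrite lee_fin.
by rewrite Fc -EFinM big_ord_recl.
Qed.

End lebesgue_euclid_product.

(** * Exponential moments of the standard Gaussian measure *)

Section hubbard_stratonovich.
Context {R : realType}.

(** Completing the square: the integrand is the constant [k] times the normal density of mean
    [c / (1 - a)] and variance [(1 - a)^-1]. *)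
Lemma integral_normal_pdf_expR (a c : R) : a < 1 ->
  (\int[@lebesgue_measure R]_t
     (normal_pdf 0 1 t * expR (a * t ^+ 2 / 2 + c * t))%:E =
   ((Num.sqrt (1 - a))^-1 * expR (c ^+ 2 / (1 - a) / 2))%:E)%E.
Proof.
move=> a1; set k := (_ * _ in RHS).
have a0 : 0 < 1 - a by rewrite subr_gt0.
pose s : R := (Num.sqrt (1 - a))^-1; pose m : R := c / (1 - a).
have s0 : s != 0 by rewrite invr_eq0 gt_eqF// sqrtr_gt0.
have s2 : s ^+ 2 = (1 - a)^-1 by rewrite exprVn sqr_sqrtr// ltW.
have kE t : normal_pdf 0 1 t * expR (a * t ^+ 2 / 2 + c * t) =
    k * normal_pdf m s t.
  have peakE : normal_peak 1 = s * normal_peak s.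
    rewrite /normal_peak -!mulrnAr !(sqrtrM (pi *+ 2) (sqr_ge0 _)).
    rewrite !sqrtr_sqr normr1 mul1r.
    by rewrite (ger0_norm (_ : 0 <= s)) ?invr_ge0 ?sqrtr_ge0// invfM mulVKf.
  rewrite !normal_pdfE ?oner_neq0//= peakE /k -/s mulrACA -!mulrA.
  congr (_ * (_ * _)); rewrite /normal_fun -!expRD s2 /m; congr expR.
  by field; rewrite gt_eqF.
under eq_integral do rewrite kE EFinM.
rewrite integralZl//=; last exact: integrable_normal_pdf.
by rewrite integral_normal_pdf mule1.
Qed.

Lemma measurable_normal_pdf_expR (a c : R) :
  measurable_fun setT
    (fun t : R => normal_pdf 0 1 t * expR (a * t ^+ 2 / 2 + c * t)).
Proof.
apply: measurable_funM; first exact: measurable_normal_pdf.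
apply: measurableT_comp => //; apply: measurable_funD.
  by apply: measurable_funM => //; apply: measurable_funM.
exact: measurable_funM.
Qed.

Lemma measurable_sum_tnth d (a : 'I_d -> R) :
  measurable_fun setT (fun x : euclid R d => \sum_(j < d) a j * tnth x j).
Proof.
apply: measurable_sum => j; apply: measurable_funM => //.
exact: (@measurable_comp_tnth _ _ id).
Qed.

Lemma measurable_expR_sqr_sum d (a : 'I_d -> R) :
  measurable_fun setT
    (fun x : euclid R d => expR ((\sum_(j < d) a j * tnth x j) ^+ 2 / 2)).
Proof.
apply: measurableT_comp => //; apply: measurable_funM => //.
by apply: measurable_funX; exact: measurable_sum_tnth.
Qed.

(* Linearizes the square: [expR (y ^+ 2 / 2)] is the Laplace transform at [y] of
   the standard normal density. *)
Lemma ge0_integral_expR_sqr d (T : measurableType d) (P : probability T R)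
    (g Y : T -> R) :
  measurable_fun setT g -> (forall x, 0 <= g x) -> measurable_fun setT Y ->
  (\int[P]_x (g x * expR (Y x ^+ 2 / 2))%:E =
   \int[@lebesgue_measure R]_t ((normal_pdf 0 1 t)%:E *
     \int[P]_x (g x * expR (t * Y x))%:E))%E.
Proof.
move=> mg g0 mY.
pose f (p : T * measurableTypeR R) :=
  (normal_pdf 0 1 p.2 * (g p.1 * expR (p.2 * Y p.1)))%:E.
have m1 (h : T -> R) : measurable_fun setT h ->
    measurable_fun setT (fun p : T * measurableTypeR R => h p.1).
  by move=> mh; exact: (measurableT_comp mh measurable_fst).
have mf : measurable_fun setT f.
  apply/measurable_EFinP; apply: measurable_funM.
    exact: (measurableT_comp (measurable_normal_pdf 0 1) measurable_snd).
  apply: measurable_funM; first exact: m1.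
  apply: measurableT_comp => //; apply: measurable_funM; last exact: m1.
  exact: measurable_snd.
have f0 p : (0 <= f p)%E.
  by rewrite lee_fin mulr_ge0 ?normal_pdf_ge0// mulr_ge0// expR_ge0.
transitivity (\int[P]_x \int[@lebesgue_measure R]_t f (x, t))%E.
  apply: eq_integral => x _; rewrite /f /=.
  (* The Gaussian integral with no quadratic term and linear coefficient [Y x] equals
     [expR (Y x ^+ 2 / 2)]. *)
  transitivity ((g x)%:E * \int[@lebesgue_measure R]_t
     (normal_pdf 0 1 t * expR (0 * t ^+ 2 / 2 + Y x * t))%:E)%E.
    rewrite integral_normal_pdf_expR// subr0 sqrtr1 invr1 mul1r mulr1.
    by rewrite EFinM.
  rewrite -ge0_integralZl//; last 3 first.
  - by apply/measurable_EFinP; exact: measurable_normal_pdf_expR.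
  - by move=> t _; rewrite lee_fin mulr_ge0 ?normal_pdf_ge0// expR_ge0.
  - by rewrite lee_fin.
  apply: eq_integral => t _; rewrite -EFinM; congr EFin.
  by rewrite mul0r mul0r add0r mulrCA (mulrC t).
rewrite (fubini_tonelli f)//.
apply: eq_integral => t _; rewrite /f /=.
under eq_integral do rewrite EFinM.
rewrite ge0_integralZl//.
- apply/measurable_EFinP; apply: measurable_funM => //.
  by apply: measurableT_comp => //; exact: measurable_funM.
- by move=> x _; rewrite lee_fin mulr_ge0// expR_ge0.
- by rewrite lee_fin normal_pdf_ge0.
Qed.

End hubbard_stratonovich.

(** * Laplace transform and squared linear forms under the standard Gaussian law on R^d *)

Section standard_gaussian.
Context {R : realType} {d : nat}.
Implicit Types (x : euclid R d) (u w : 'I_d -> R).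

Lemma gaussian_pdf_ge0 (m : 'rV[R]_d) (V : 'M[R]_d) x :
  0 <= gaussian_pdf m V x.
Proof. by rewrite mulr_ge0 ?invr_ge0 ?sqrtr_ge0 ?expR_ge0. Qed.

Lemma measurable_gaussian_pdf (m : 'rV[R]_d) (V : 'M[R]_d) :
  measurable_fun setT (gaussian_pdf m V).
Proof.
apply: measurable_funM => //; apply: measurableT_comp => //.
apply: measurable_funM => //; apply: measurable_funN.
under eq_fun => x.
  rewrite mxE; under eq_bigr do rewrite !mxE; over.
have mc j : measurable_fun setT (fun x : euclid R d => tnth x j - m 0 j).
  apply: measurable_funB => //; exact: (@measurable_comp_tnth _ _ id).
apply: measurable_sum => k; apply: measurable_funM; last exact: mc.
apply: measurable_sum => j; apply: measurable_funM => //.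
by under eq_fun do rewrite !mxE; exact: mc.
Qed.

Lemma gaussian_pdf_std x :
  gaussian_pdf 0 1%:M x = \prod_(j < d) normal_pdf 0 1 (tnth x j).
Proof.
rewrite /gaussian_pdf subr0 invmx1 mulmx1 det1 mulr1.
under eq_bigr do rewrite normal_pdfE ?oner_neq0// /normal_fun subr0.
rewrite big_split /= prodr_const card_ord -expR_sum; congr (_ * expR _).
  rewrite /normal_peak expr1n mul1r mulr_natl exprVn; congr (_^-1).
  elim: d => [|n IH]; first by rewrite !expr0 sqrtr1.
  by rewrite !exprS sqrtrM ?IH// mulrn_wge0// pi_ge0.
rewrite mxE -sumrN mulr_suml; apply: eq_bigr => j _.
by rewrite !mxE expr1n -expr2.
Qed.

Variable P : probability (euclid R d) R.
Hypothesis Pstd : is_gaussian 0 1%:M P.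

Lemma ge0_integral_std (g : euclid R d -> R) :
  measurable_fun setT g -> (forall x, 0 <= g x) ->
  (\int[P]_x (g x)%:E =
   \int[lebesgue_euclid R d]_x (g x * gaussian_pdf 0 1%:M x)%:E)%E.
Proof.
move=> mg g0; rewrite (ge0_integral_density _ _ _ _ _ _
  (measurable_gaussian_pdf 0 1%:M) (gaussian_pdf_ge0 0 1%:M) Pstd)//.
exact/measurable_EFinP.
Qed.

(** The integrand and the density both factor over the coordinates, and each factor is a
    one-dimensional Gaussian integral without quadratic term. *)
Lemma integral_std_expR u :
  (\int[P]_x (expR (\sum_(j < d) u j * tnth x j))%:E =
   (expR ((\sum_(j < d) u j ^+ 2) / 2))%:E)%E.
Proof.
rewrite ge0_integral_std//; last first.
  by apply: measurableT_comp => //; exact: measurable_sum_tnth.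
under eq_integral do
  rewrite gaussian_pdf_std expR_sum -big_split /=.
rewrite (ge0_integral_prod_lebesgue_euclid d
  (fun j t => expR (u j * t) * normal_pdf 0 1 t) (fun j => expR (u j ^+ 2 / 2))).
- by rewrite mulr_suml expR_sum.
- move=> j; apply: measurable_funM; last exact: measurable_normal_pdf.
  by apply: measurableT_comp => //; exact: measurable_funM.
- by move=> j t; rewrite mulr_ge0 ?expR_ge0 ?normal_pdf_ge0.
move=> j; transitivity (\int[@lebesgue_measure R]_t
   (normal_pdf 0 1 t * expR (0 * t ^+ 2 / 2 + u j * t))%:E)%E.
  by apply: eq_integral => t _; rewrite mulrC !mul0r add0r.
by rewrite integral_normal_pdf_expR// subr0 sqrtr1 invr1 mul1r mulr1.
Qed.

(** Both squares are linearized by auxiliary normal variables, [t] for [u] and [s] for [w]. The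
    integral over [P] becomes a Laplace transform, and two one-dimensional Gaussian integrals
    remain. The quantity under the root is the determinant of the identity minus the Gram matrix of
    [u] and [w]. *)
Lemma integral_std_expR_sqr u w (U W r : R) :
  \sum_(j < d) u j ^+ 2 = U -> \sum_(j < d) w j ^+ 2 = W ->
  \sum_(j < d) u j * w j = r ->
  W < 1 -> r ^+ 2 < (1 - U) * (1 - W) ->
  (\int[P]_x (expR ((\sum_(j < d) u j * tnth x j) ^+ 2 / 2) *
              expR ((\sum_(j < d) w j * tnth x j) ^+ 2 / 2))%:E =
   ((Num.sqrt ((1 - U) * (1 - W) - r ^+ 2))^-1)%:E)%E.
Proof.
move=> uU wW uwr W1 rUW.
have W0 : 0 < 1 - W by rewrite subr_gt0.
have mY v : measurable_fun setT (fun x : euclid R d => \sum_(j < d) v j * tnth x j).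
  exact: measurable_sum_tnth.
under eq_integral do rewrite mulrC.
rewrite ge0_integral_expR_sqr//; last exact: measurable_expR_sqr_sum.
(* [a] is the coefficient of [t ^+ 2 / 2] once [s] is integrated out; [a < 1] is exactly the
   assumption [r ^+ 2 < (1 - U) * (1 - W)]. *)
pose a := U + r ^+ 2 / (1 - W).
transitivity (\int[@lebesgue_measure R]_t ((Num.sqrt (1 - W))^-1%:E *
   (normal_pdf 0 1 t * expR (a * t ^+ 2 / 2 + 0 * t))%:E))%E; last first.
  have a1 : a < 1.
    by rewrite -ltrBrDl ltr_pdivrMr.
  rewrite ge0_integralZl//; last 2 first.
  - by apply/measurable_EFinP; exact: measurable_normal_pdf_expR.
  - by move=> t _; rewrite lee_fin mulr_ge0 ?normal_pdf_ge0// expR_ge0.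
  rewrite integral_normal_pdf_expR// expr0n/= !mul0r expR0 mulr1 -EFinM -invfM.
  rewrite -sqrtrM ?ltW//; congr (Num.sqrt _)^-1%:E.
  by rewrite /a; field; rewrite gt_eqF.
apply: eq_integral => t _.
under eq_integral do rewrite mulrC.
rewrite ge0_integral_expR_sqr//; last first.
  by apply: measurableT_comp => //; apply: measurable_funM.
transitivity ((normal_pdf 0 1 t)%:E * \int[@lebesgue_measure R]_s
   ((expR (t ^+ 2 * U / 2))%:E * (normal_pdf 0 1 s *
     expR (W * s ^+ 2 / 2 + t * r * s))%:E))%E.
  congr (_ * _)%E; apply: eq_integral => s _.
  under eq_integral => x _.
    rewrite -expRD !mulr_sumr -big_split /=.
    under eq_bigr => j _ do rewrite !mulrA -mulrDl.
    over.
  rewrite (integral_std_expR (fun j => t * u j + s * w j)) -!EFinM.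
  rewrite mulrCA -expRD; congr (_ * expR _)%:E.
  rewrite (_ : \sum_(j < d) (t * u j + s * w j) ^+ 2 =
    t ^+ 2 * U + 2 * t * s * r + s ^+ 2 * W); first by field.
  rewrite -uU -wW -uwr !mulr_sumr -!big_split /=.
  by apply: eq_bigr => j _; ring.
rewrite ge0_integralZl//; last 2 first.
- by apply/measurable_EFinP; exact: measurable_normal_pdf_expR.
- by move=> s _; rewrite lee_fin mulr_ge0 ?normal_pdf_ge0// expR_ge0.
rewrite integral_normal_pdf_expR// -!EFinM; congr EFin.
rewrite [RHS]mulrCA; congr (_ * _); rewrite mulrCA -expRD; congr (_ * expR _).
by rewrite /a; field; rewrite gt_eqF.
Qed.

End standard_gaussian.

(** * Likelihood ratios of the spiked model *)

Section spiked_likelihood.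
Context {R : realType} {d : nat}.
Variables (s : nat) (beta : R).
Hypotheses (s0 : (0 < s)%N) (beta0 : 0 < beta).
Implicit Types (S : {set 'I_d}) (x : euclid R d).

(** For [#|S| = s] this is the density of the spiked Gaussian law with respect to the standard one:
    the covariance has determinant [1 + beta], and its inverse lowers the quadratic form by
    [beta / (1 + beta)] times the squared projection on the spike. The square root sits in the
    coefficients so that the exponent is half the square of a linear form. *)
Definition spiked_lr S x : R :=
  (Num.sqrt (1 + beta))^-1 *
  expR ((\sum_(j < d) Num.sqrt (beta / (1 + beta)) * spike s S j 0 * tnth x j)
          ^+ 2 / 2).

Lemma sum_spike (S S' : {set 'I_d}) :
  \sum_(j < d) @spike R d s S j 0 * spike s S' j 0 = #|S :&: S'|%:R / s%:R.
Proof.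
under eq_bigr do rewrite !mxE.
rewrite (bigID (mem (S :&: S'))) /= [X in _ + X]big1 ?addr0; last first.
  by move=> j; rewrite inE negb_and => /orP[]/negbTE ->; rewrite ?mulr0 ?mul0r.
under eq_bigr => j.
  rewrite inE => /andP[-> ->]; rewrite -invfM -expr2 sqr_sqrtr ?ler0n//; over.
by rewrite sumr_const mulr_natl.
Qed.

Lemma spiked_lr_ge0 S x : 0 <= spiked_lr S x.
Proof. by rewrite mulr_ge0 ?invr_ge0 ?sqrtr_ge0 ?expR_ge0. Qed.

Lemma measurable_spiked_lr S : measurable_fun setT (spiked_lr S).
Proof.
by apply: measurable_funM => //; exact: measurable_expR_sqr_sum.
Qed.

Variable P0 : probability (euclid R d) R.
Hypothesis P0std : is_gaussian 0 1%:M P0.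

Let gamma : R := beta / (1 + beta).
Let b1 : 0 < 1 + beta. Proof. by rewrite addr_gt0. Qed.
Let gamma_ge0 : 0 <= gamma. Proof. by rewrite divr_ge0 ?ltW. Qed.
Let gammaC : 1 - gamma = (1 + beta)^-1.
Proof. by rewrite /gamma; field; rewrite gt_eqF. Qed.

Let sum_u (S S' : {set 'I_d}) : \sum_(j < d) Num.sqrt gamma * spike s S j 0 *
  (Num.sqrt gamma * spike s S' j 0) = gamma * (#|S :&: S'|%:R / s%:R).
Proof.
rewrite -sum_spike mulr_sumr; apply: eq_bigr => j _.
by rewrite mulrACA -expr2 sqr_sqrtr.
Qed.

Let sum_u2 S : #|S| = s ->
  \sum_(j < d) (Num.sqrt gamma * spike s S j 0) ^+ 2 = gamma.
Proof.
move=> Ss; under eq_bigr do rewrite expr2.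
by rewrite sum_u finset.setIid Ss divff ?mulr1// pnatr_eq0 -lt0n.
Qed.

(** The formula for two squared forms applies with [U = W = gamma] and [r = gamma * rho]. As
    [1 - gamma] is the inverse of [1 + beta], the normalizing factors cancel. The bound [beta < 1]
    keeps the moment finite even at full overlap, [rho = 1]. *)
Lemma integral_spiked_lr2 S S' : #|S| = s -> #|S'| = s -> beta < 1 ->
  (\int[P0]_x (spiked_lr S x * spiked_lr S' x)%:E =
   (Num.sqrt (1 - (beta * (#|S :&: S'|%:R / s%:R)) ^+ 2))^-1%:E)%E.
Proof.
move=> Ss S's beta1; set rho := _ / s%:R.
have rho0 : 0 <= rho by rewrite divr_ge0.
have rho1 : rho <= 1.
  rewrite ler_pdivrMr ?ltr0n// mul1r ler_nat -Ss.
  by rewrite subset_leq_card// finset.subsetIl.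
have brho : (beta * rho) ^+ 2 < 1.
  rewrite expr_lt1//; last by rewrite mulr_ge0// ltW.
  by rewrite (le_lt_trans _ beta1)// ler_piMr// ltW.
have detE : (1 - gamma) * (1 - gamma) - (gamma * rho) ^+ 2 =
    (1 + beta)^-1 ^+ 2 * (1 - (beta * rho) ^+ 2).
  by rewrite gammaC /gamma; field; rewrite gt_eqF.
under eq_integral => x _ do rewrite mulrACA EFinM.
rewrite ge0_integralZl//; last first.
  by apply/measurable_EFinP; apply: measurable_funM;
    exact: measurable_expR_sqr_sum.
rewrite (integral_std_expR_sqr _ P0std _ _ _ _ _
  (sum_u2 S Ss) (sum_u2 S' S's) (sum_u S S')) -/rho; last 2 first.
- by rewrite -subr_gt0 gammaC invr_gt0.
- by rewrite -subr_gt0 detE mulr_gt0 ?exprn_gt0 ?invr_gt0// subr_gt0.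
rewrite detE sqrtrM ?sqr_ge0// sqrtr_sqr ger0_norm ?invr_ge0 ?ltW//.
rewrite -EFinM -[X in (X * _)%:E]invfM -expr2 sqr_sqrtr ?ltW// invfM mulVKf//.
by rewrite invr_eq0 gt_eqF.
Qed.

(** An instance of Sherman-Morrison: [#|S| = s] makes the spike a unit vector, so [A] is idempotent
    and the candidate inverse is checked by multiplication. *)
Lemma invmx_spiked_cov S : #|S| = s ->
  invmx (spiked_cov s beta S) =
  1%:M - gamma *: (spike s S *m (spike s S)^T).
Proof.
move=> Ss; set v := spike s S; set A := v *m v^T.
have AA : A *m A = A.
  rewrite /A mulmxA -(mulmxA v) (_ : v^T *m v = 1%:M) ?mulmx1//.
  apply/matrixP => i j; rewrite !ord1 mxE mxE eqxx.
  under eq_bigr do rewrite mxE.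
  by rewrite sum_spike finset.setIid Ss divff// pnatr_eq0 -lt0n.
have VB : spiked_cov s beta S *m (1%:M - gamma *: A) = 1%:M.
  rewrite /spiked_cov -/v -/A mulmxBr mulmx1 mulmxDl mul1mx -scalemxAl -scalemxAr.
  rewrite AA scalerA -scalerDl -addrA -scalerBl.
  rewrite [X in X *: A](_ : _ = 0) ?scale0r ?addr0// /gamma.
  by field; rewrite gt_eqF.
by have [Vu _] := mulmx1_unit VB; rewrite -[RHS](mulKmx Vu) VB mulmx1.
Qed.

Lemma gaussian_pdf_spiked S x : #|S| = s ->
  gaussian_pdf 0 (spiked_cov s beta S) x =
  Num.sqrt ((2 * pi) ^+ d) / Num.sqrt ((2 * pi) ^+ d * \det (spiked_cov s beta S))
  * Num.sqrt (1 + beta) * spiked_lr S x * gaussian_pdf 0 1%:M x.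
Proof.
move=> Ss; rewrite /gaussian_pdf /spiked_lr subr0 invmx_spiked_cov// invmx1.
rewrite det1 mulr1 mulmx1 -/gamma; set y := rowv x; set v := spike s S.
set D := \sum_(j < d) _.
have DE : D = Num.sqrt gamma * (y *m v) 0 0.
  rewrite mxE mulr_sumr; apply: eq_bigr => j _.
  by rewrite [y _ _]mxE mulrAC mulrA.
have -> : (y *m (1%:M - gamma *: (v *m v^T)) *m y^T) 0 0 =
    (y *m y^T) 0 0 - D ^+ 2.
  rewrite mulmxBr mulmx1 mulmxBl -scalemxAr -scalemxAl.
  rewrite (mulmxA y) -(mulmxA _ v^T) -trmx_mul.
  rewrite mxE; congr (_ + _); rewrite mxE; congr (- _).
  rewrite mxE [in LHS]mxE big_ord1 [_^T _ _]mxE DE exprMn.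
  by rewrite sqr_sqrtr// expr2.
rewrite opprB (mulrDl (D ^+ 2)) expRD.
have p0 : Num.sqrt ((2 * pi : R) ^+ d) != 0.
  by rewrite gt_eqF// sqrtr_gt0 exprn_gt0// mulr_gt0// pi_gt0.
have q0 : Num.sqrt (1 + beta) != 0 by rewrite gt_eqF// sqrtr_gt0.
set k := (Num.sqrt (_ * \det _))^-1.
by field; rewrite p0.
Qed.

(** The formula for two squared forms, with the zero form [z] as the first one. *)
Lemma integral_spiked_lr S : #|S| = s ->
  (\int[P0]_x (spiked_lr S x)%:E = 1)%E.
Proof.
move=> Ss; pose z : 'I_d -> R := fun=> 0.
pose w j := Num.sqrt gamma * @spike R d s S j 0.
have sumz (a : 'I_d -> R) : \sum_(j < d) z j * a j = 0.
  by rewrite big1// => j _; rewrite mul0r.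
have sumz2 : \sum_(j < d) z j ^+ 2 = 0 by under eq_bigr do rewrite expr2.
transitivity (\int[P0]_x ((Num.sqrt (1 + beta))^-1%:E *
   (expR ((\sum_(j < d) z j * tnth x j) ^+ 2 / 2) *
    expR ((\sum_(j < d) w j * tnth x j) ^+ 2 / 2))%:E))%E.
  apply: eq_integral => x _; rewrite sumz expr0n mul0r expR0 mul1r -EFinM.
  by [].
rewrite ge0_integralZl//; last first.
  by apply/measurable_EFinP; apply: measurable_funM;
    exact: measurable_expR_sqr_sum.
rewrite (integral_std_expR_sqr _ P0std _ _ _ _ _
  sumz2 (sum_u2 S Ss) (sumz w))//; last 2 first.
- by rewrite -subr_gt0 gammaC invr_gt0.
- by rewrite subr0 mul1r expr0n gammaC invr_gt0.
rewrite subr0 mul1r expr0n subr0 gammaC -EFinM -invfM -sqrtrM ?ltW//.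
by rewrite divff ?sqrtr1 ?invr1// gt_eqF.
Qed.

Lemma ge0_integral_spiked S (P : probability (euclid R d) R)
    (g : euclid R d -> R) :
  #|S| = s -> is_gaussian 0 (spiked_cov s beta S) P ->
  measurable_fun setT g -> (forall x, 0 <= g x) ->
  (\int[P]_x (g x)%:E = \int[P0]_x (g x * spiked_lr S x)%:E)%E.
Proof.
move=> Ss PS.
(* Total mass identifies [k], so [\det (spiked_cov _ _ _)] is never computed. *)
have [k k0 kE] : exists2 k : R, 0 <= k & forall x,
    gaussian_pdf 0 (spiked_cov s beta S) x =
    k * spiked_lr S x * gaussian_pdf 0 1%:M x.
  eexists; last by move=> x; exact: gaussian_pdf_spiked.
  by rewrite mulr_ge0 ?sqrtr_ge0// divr_ge0 ?sqrtr_ge0.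
have PE (h : euclid R d -> R) : measurable_fun setT h -> (forall x, 0 <= h x) ->
    (\int[P]_x (h x)%:E = \int[P0]_x (k%:E * (h x * spiked_lr S x)%:E))%E.
  move=> mh h0; rewrite (ge0_integral_density _ _ _ _ _ _
    (measurable_gaussian_pdf 0 _) (gaussian_pdf_ge0 0 _) PS)//; last first.
    exact/measurable_EFinP.
  under [RHS]eq_integral do rewrite -EFinM.
  rewrite (ge0_integral_std _ P0std); last 2 first.
  - apply: measurable_funM => //; apply: measurable_funM => //.
    exact: measurable_spiked_lr.
  - by move=> x; rewrite !mulr_ge0 ?spiked_lr_ge0.
  apply: eq_integral => x _; rewrite -EFinM kE; congr EFin; ring.
have kint (h : euclid R d -> R) : measurable_fun setT h -> (forall x, 0 <= h x) ->
    (\int[P]_x (h x)%:E = k%:E * \int[P0]_x (h x * spiked_lr S x)%:E)%E.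
  move=> mh h0; rewrite PE// ge0_integralZl//.
    apply/measurable_EFinP; apply: measurable_funM => //.
    exact: measurable_spiked_lr.
  by move=> x _; rewrite lee_fin mulr_ge0 ?spiked_lr_ge0.
have k1 : k = 1.
  have := kint (cst 1) (measurable_cst _) (fun=> ler01).
  have := expectation_cst P (1 : R); rewrite unlock => ->.
  rewrite (eq_integral (fun x => (spiked_lr S x)%:E)); last first.
    by move=> x _; rewrite mul1r.
  rewrite integral_spiked_lr// mule1.
  by move=> [].
by move=> mg g0; rewrite kint// k1 mul1e.
Qed.

End spiked_likelihood.

(** * Second moment bound *)

Section covariance_sum.
Local Open Scope ereal_scope.
Context d (T : measurableType d) (R : realType) (P : probability T R).

Lemma Lfun2P (f : T -> R) : measurable_fun setT f ->
  \int[P]_x (f x ^+ 2)%:E < +oo -> f \in Lfun P 2%:E.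
Proof.
move=> mf fy; rewrite inE; apply/andP; split; rewrite inE//= /finite_norm.
rewrite (@lty_poweRy _ _ 2)// powR_Lnorm//.
apply: le_lt_trans fy; under eq_integral => x _.
  rewrite abse_EFin poweR_EFin powR_mulrn// -normrX ger0_norm ?sqr_ge0//; over.
by [].
Qed.

Lemma Lfun2_sum (I : Type) (r : seq I) (a : I -> R) (Y : I -> T -> R) :
  (forall i, Y i \in Lfun P 2%:E) ->
  (fun x => \sum_(i <- r) a i * Y i x)%R \in Lfun P 2%:E.
Proof.
move=> Y2; elim: r => [|i r IH].
  under eq_fun do rewrite big_nil; exact: Lfun_cst.
rewrite (_ : (fun x => _) =
  (a i \o* Y i) + (fun x => \sum_(i <- r) a i * Y i x))%R; last first.
  by apply/funext => x /=; rewrite big_cons mulrC.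
by rewrite rpredD ?lee1n// => ?; rewrite Lfun_scale// ler1n.
Qed.

Lemma covariance_suml (I : Type) (r : seq I) (a : I -> R)
    (X : T -> R) (Y : I -> T -> R) :
  X \in Lfun P 2%:E -> (forall i, Y i \in Lfun P 2%:E) ->
  covariance P (fun x => \sum_(i <- r) a i * Y i x)%R X =
  \sum_(i <- r) (a i)%:E * covariance P (Y i) X.
Proof.
move=> X2 Y2; elim: r => [|i r IH].
  by under eq_fun do rewrite big_nil; rewrite covariance_cst_l big_nil.
under eq_fun do rewrite big_cons.
have Pfin : P setT \is a fin_num := fin_num_measure P _ measurableT.
have aY2 : (a i \o* Y i)%R \in Lfun P 2%:E by rewrite Lfun_scale ?ler1n.
have X1 := Lfun_subset12 Pfin X2.
have Y1 := Lfun_subset12 Pfin (Y2 i).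
rewrite big_cons -IH -(covarianceZl _ Y1 X1 (Lfun2_mul_Lfun1 (Y2 i) X2)).
rewrite -(covarianceDl aY2 (Lfun2_sum _ _ _ _ Y2) X2).
by congr covariance; apply/funext => x /=; rewrite (mulrC (a i)).
Qed.

End covariance_sum.

(** * Cauchy-Schwarz for a family correlated with one query *)

Section correlated_family.
Context d (T : measurableType d) (R : realType) (P : probability T R).
Context (I : finType) (L : I -> T -> R) (B : I -> I -> R).
Hypothesis L2 : forall i, L i \in Lfun P 2%:E.

Let Pfin : P setT \is a fin_num := fin_num_measure P _ measurableT.

Let cov_fin (X Y : T -> R) : X \in Lfun P 2%:E -> Y \in Lfun P 2%:E ->
  covariance P X Y \is a fin_num.
Proof.
move=> X2 Y2; apply: covariance_fin_num; last exact: Lfun2_mul_Lfun1.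
- exact: (Lfun_subset12 Pfin).
- exact: (Lfun_subset12 Pfin).
Qed.

(** The signs [a i] make the covariance of [W] with [q] equal to [N], the sum of the absolute
    covariances, which exceeds [#|D|%:R * Num.sqrt (v * t)]. Cauchy-Schwarz bounds [N ^+ 2] by [v]
    times the variance of [W], itself at most the double sum of [B]. *)
Lemma card_correlated (D : {set I}) (q : T -> R) (t : R) :
  q \in Lfun P 2%:E -> 0 <= t ->
  {in D &, forall i j, `|fine (covariance P (L i) (L j))| <= B i j} ->
  {in D, forall i, Num.sqrt (fine 'V_P[q] * t) < `|fine (covariance P (L i) q)|} ->
  #|D|%:R ^+ 2 * t <= \sum_(i in D) \sum_(j in D) B i j.
Proof.
move=> q2 t0 LB Lq; set v := fine 'V_P[q].
have v0 : 0 <= v by rewrite fine_ge0 ?variance_ge0.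
have [->|/set0Pn[i0 Di0]] := eqVneq D finset.set0.
  by rewrite cards0 expr0n mul0r big_set0.
pose c i := fine (covariance P (L i) q); pose a i := Num.sg (c i).
pose W x := \sum_(i <- enum D) a i * L i x.
have W2 : W \in Lfun P 2%:E by exact: Lfun2_sum.
pose N := \sum_(i in D) `|c i|.
have covW (X : T -> R) : X \in Lfun P 2%:E -> covariance P W X =
    (\sum_(i in D) a i * fine (covariance P (L i) X))%:E.
  move=> X2; rewrite covariance_suml// -sumEFin big_enum /=.
  by apply: eq_bigr => i _; rewrite EFinM fineK// cov_fin.
have WqE : covariance P W q = N%:E.
  by rewrite covW//; congr EFin; apply: eq_bigr => i _; rewrite -normrEsg.
have WWE : fine 'V_P[W] <= \sum_(i in D) \sum_(j in D) B i j.
  rewrite /variance covW//=; apply: ler_sum => i Di.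
  rewrite covarianceC covW//= mulr_sumr; apply: ler_sum => j Dj.
  rewrite (le_trans (ler_norm _))// !normrM !normr_sg mulrA -natrM.
  rewrite covarianceC (le_trans _ (LB _ _ Di Dj))// ler_piMl// lern1.
  by case: (_ != 0); case: (_ != 0).
have N0 : 0 <= N by apply: sumr_ge0.
have NltE : #|D|%:R * Num.sqrt (v * t) < N.
  rewrite mulr_natl -sumr_const; apply: ltr_sum => //.
  by apply/hasP; exists i0; rewrite ?mem_index_enum.
have NvW : N ^+ 2 <= v * \sum_(i in D) \sum_(j in D) B i j.
  have := covariance_le W2 q2.
  rewrite WqE -(fineK (variance_fin_num W2)) -(fineK (variance_fin_num q2)) /=.
  rewrite lee_fin => NW.
  rewrite (le_trans _ (ler_wpM2l v0 WWE))//.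
  have VW0 : 0 <= fine 'V_P[W] by rewrite fine_ge0 ?variance_ge0.
  rewrite -[leRHS]sqr_sqrtr ?mulr_ge0// ler_sqr ?nnegrE ?sqrtr_ge0//.
  by rewrite sqrtrM// mulrC.
have : v * (#|D|%:R ^+ 2 * t) < v * \sum_(i in D) \sum_(j in D) B i j.
  apply: lt_le_trans NvW; rewrite mulrCA -[v * t]sqr_sqrtr ?mulr_ge0// -exprMn.
  by rewrite ltr_sqr ?nnegrE ?mulr_ge0 ?sqrtr_ge0.
(* At variance 0 the strict inequality reads [0 < 0]: a constant query correlates with nothing, so a
   nonempty [D] is contradictory. *)
have [->|vN0] := eqVneq v 0; first by rewrite !mul0r ltxx.
have vgt0 : 0 < v by rewrite lt_neqAle eq_sym vN0.
by rewrite (ltr_pM2l vgt0); exact: ltW.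
Qed.

End correlated_family.

(** * Spiked likelihood ratios against bounded queries *)

Section detection_bound.
Context {R : realType} {d : nat}.
Variables (s : nat) (beta b : R).
Hypotheses (s0 : (0 < s)%N) (beta0 : 0 < beta) (beta2 : beta <= 2^-1).
Variables (P0 : probability (euclid R d) R)
  (PS : {set 'I_d} -> probability (euclid R d) R).
Hypothesis P0std : is_gaussian 0 1%:M P0.
Hypothesis PSspiked : forall S, S \in candidates d s ->
  is_gaussian 0 (spiked_cov s beta S) (PS S).

Implicit Types (S : {set 'I_d}) (q : euclid R d -> R).

Let rho (S S' : {set 'I_d}) : R := #|S :&: S'|%:R / s%:R.

(** The upper bound amounts to [1 <= (1 + z) ^+ 2 * (1 - z)], whose right side is
    [1 + z * (1 - z - z * z)]. *)
Lemma invr_sqrt_bounds (z : R) : 0 <= z <= 2^-1 ->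
  1 <= (Num.sqrt (1 - z))^-1 <= 1 + z.
Proof.
move=> /andP[z0 z2]; have z1 : 0 < 1 - z by lra.
have r0 : 0 < Num.sqrt (1 - z) by rewrite sqrtr_gt0.
apply/andP; split.
  rewrite invf_ge1// -[leRHS]sqrtr1 ler_wsqrtr//; lra.
have z3 : 0 <= 1 + z by lra.
rewrite -[leLHS]mul1r ler_pdivrMr// -(@ler_pXn2r _ 2) ?nnegrE ?mulr_ge0 ?sqrtr_ge0//.
rewrite exprMn (sqr_sqrtr (ltW z1)) expr1n.
rewrite (_ : _ * _ = 1 + z * (1 - z - z * z)); last by ring.
by rewrite lerDl mulr_ge0//; nra.
Qed.

Let beta1 : beta < 1.
Proof. by rewrite (le_lt_trans beta2)// invf_lt1// ltr1n. Qed.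

Lemma Lfun2_spiked_lr S : #|S| = s -> spiked_lr s beta S \in Lfun P0 2%:E.
Proof.
move=> Ss; apply: Lfun2P; first exact: measurable_spiked_lr.
under eq_integral do rewrite expr2.
by rewrite integral_spiked_lr2// ltry.
Qed.

(** Both ratios have mean 1, so the covariance is the second moment minus 1; [beta <= 2^-1] brings
    the squared overlap into the range of [invr_sqrt_bounds]. *)
Lemma covariance_spiked_lr S S' : #|S| = s -> #|S'| = s ->
  `|fine (covariance P0 (spiked_lr s beta S) (spiked_lr s beta S'))| <=
  (beta * rho S S') ^+ 2.
Proof.
move=> Ss S's.
have Pfin : P0 setT \is a fin_num := fin_num_measure P0 _ measurableT.
have L2 := Lfun2_spiked_lr _ Ss; have L2' := Lfun2_spiked_lr _ S's.
rewrite (covarianceE (Lfun_subset12 Pfin L2) (Lfun_subset12 Pfin L2')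
  (Lfun2_mul_Lfun1 L2 L2')).
rewrite unlock !integral_spiked_lr// mule1.
rewrite (integral_spiked_lr2 _ _ s0 beta0 _ P0std)//= -/(rho _ _).
have rho0 : 0 <= rho S S' by rewrite divr_ge0.
have rho1 : rho S S' <= 1.
  rewrite ler_pdivrMr ?ltr0n// mul1r ler_nat -Ss.
  by rewrite subset_leq_card// finset.subsetIl.
set z := (_ ^+ 2); have z02 : 0 <= z <= 2^-1.
  have br0 : 0 <= beta * rho S S' by rewrite mulr_ge0// ltW.
  have br2 := le_trans (ler_piMr (ltW beta0) rho1) beta2.
  by rewrite sqr_ge0/= /z; move: (beta * rho S S') br0 br2 => r; nra.
have /andP[? ?] := invr_sqrt_bounds _ z02.
by rewrite ger0_norm ?subr_ge0// lerBlDl.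
Qed.

Lemma Lfun2_query q : q \in queries d b -> forall P : probability (euclid R d) R,
  q \in Lfun P 2%:E.
Proof.
rewrite inE => -[mq qb] P; apply: Lfun2P => //.
apply: (@le_lt_trans _ _ (\int[P]_x (b ^+ 2)%:E)%E); last first.
  by have := expectation_cst P (b ^+ 2); rewrite unlock => ->; rewrite ltry.
apply: ge0_le_integral => //.
- by move=> x _; rewrite lee_fin sqr_ge0.
- exact/measurable_EFinP/measurable_funX.
by move=> x _; rewrite lee_fin; have /andP[? ?] := qb x; nra.
Qed.

Lemma covariance_lr_query S q : #|S| = s -> q \in queries d b ->
  covariance P0 (spiked_lr s beta S) q = ('E_(PS S)[q] - 'E_P0[q])%E.
Proof.
move=> Ss qQ; have := qQ; rewrite inE => -[mq qb].
have fin (P : probability (euclid R d) R) : P setT \is a fin_num.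
  exact: fin_num_measure.
have q1 (P : probability (euclid R d) R) : q \in Lfun P 1%E.
  exact: (Lfun_subset12 (fin P) (Lfun2_query _ qQ P)).
have L2 := Lfun2_spiked_lr _ Ss; have L1 := Lfun_subset12 (fin P0) L2.
have Lq1 := Lfun2_mul_Lfun1 L2 (Lfun2_query _ qQ P0).
have E1 : ('E_P0[spiked_lr s beta S] = 1)%E by rewrite unlock integral_spiked_lr.
rewrite (covarianceE L1 (q1 P0) Lq1) E1 mul1e; congr (_ - _)%E.
have b1 (P : probability (euclid R d) R) : cst b \in Lfun P 1%E by exact: Lfun_cst.
have SC : is_gaussian 0 (spiked_cov s beta S) (PS S).
  by apply: PSspiked; rewrite inE Ss.
(* Adding [b] makes the query nonnegative, as the change of measure requires; the shift adds [b] to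
   both expectations because the ratio has mean 1. *)
have mqb : measurable_fun setT (q \+ cst b) by exact: measurable_funD.
have qb0 x : 0 <= (q \+ cst b) x by have /andP[/= ? _] := qb x; lra.
have : ('E_(PS S)[(q \+ cst b)%R] = 'E_P0[(spiked_lr s beta S * q)%R] + b%:E)%E.
  transitivity ('E_P0[(spiked_lr s beta S * q \+ b \o* spiked_lr s beta S)%R])%E.
    rewrite unlock (ge0_integral_spiked s beta s0 beta0 P0 P0std S (PS S)
      (q \+ cst b) Ss SC mqb qb0).
    apply: eq_integral => x _.
    by rewrite mulrDl (mulrC (q x)) (mulrC (cst b x)).
  rewrite expectationD//; last by rewrite Lfun_scale.
  by rewrite expectationZl// E1 mule1.
rewrite expectationD// expectation_cst => /(congr1 (fun z => z - b%:E)%E).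
by rewrite !addeK.
Qed.

Lemma card_detected_sqr (n : nat) (xi l : R) q
    (D := detected s b n xi P0 PS q) :
  (0 < n)%N -> 0 <= l -> log_inv xi = l%:E -> q \in queries d b ->
  #|D|%:R ^+ 2 * (2 * l / n%:R) <=
  \sum_(S in D) \sum_(S' in D) (beta * rho S S') ^+ 2.
Proof.
move=> n0 l0 xil qQ.
(* [spiked_lr s beta S] need not be square integrable unless #|S| = s. *)
pose L S := if #|S| == s then spiked_lr s beta S else cst 0.
have DL S : S \in D -> #|S| = s /\ L S = spiked_lr s beta S.
  by rewrite inE => /andP[]; rewrite inE /L => /eqP -> _; rewrite eqxx.
apply: (card_correlated _ _ _ P0 _ L _ _ D q).
- move=> S; rewrite /L; case: eqP => [Ss|_]; first exact: Lfun2_spiked_lr.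
  exact: Lfun_cst.
- exact: Lfun2_query.
- by rewrite divr_ge0// mulr_ge0.
- by move=> S S' /DL[Ss ->] /DL[S's ->]; exact: covariance_spiked_lr.
move=> S SD; have [Ss ->] := DL _ SD.
rewrite covariance_lr_query//; move: SD; rewrite inE => /andP[_].
have q2 := Lfun2_query _ qQ.
have fin (P : probability (euclid R d) R) : P setT \is a fin_num.
  exact: fin_num_measure.
have q1 (P : probability (euclid R d) R) : q \in Lfun P 1%E.
  exact: (Lfun_subset12 (fin P) (q2 P)).
rewrite -(fineK (expectation_fin_num (q1 (PS S)))).
rewrite -(fineK (expectation_fin_num (q1 P0))) -EFinB /=.
rewrite -lte_fin; apply: le_lt_trans.
(* The tolerance dominates its variance term, which is the threshold of [card_correlated] at
   [t = 2 * l / n%:R]. *)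
rewrite /tolerance le_max xil; apply/orP; right.
rewrite -{2}(fineK (variance_fin_num (q2 P0))) inver pnatr_eq0 eqn0Ngt n0 /=.
rewrite lee_fin (_ : _ * (_ / _) = 2 * fine 'V_P0[q] * l / n%:R)//.
by rewrite mulrA mulrCA !mulrA.
Qed.

End detection_bound.

(** * Counting intersecting sets *)

Lemma leq_bin_expn n m : ('C(n, m) <= n ^ m)%N.
Proof.
elim: m n => [|m IH] [|n]; rewrite ?bin0 ?bin0n//.
rewrite -(leq_pmul2l (ltn0Sn m)) -mul_bin_diag /= expnS mulnCA.
rewrite leq_mul2l /= (leq_trans (IH n))// (@leq_trans (n.+1 ^ m))%N//.
  by case: m {IH} => // m; rewrite leq_exp2r.
by rewrite leq_pmull.
Qed.

(** Adjoining [K] is a bijection from the subsets of size [s - #|K|] of its complement. *)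
Lemma card_supersets (T : finType) (K : {set T}) (s : nat) : (#|K| <= s)%N ->
  #|[set S : {set T} | (K \subset S) && (#|S| == s)]%SET| =
  'C(#|T| - #|K|, s - #|K|).
Proof.
move=> Ks; rewrite -(cardsC K) addKn -cards_draws.
rewrite -[RHS](@card_in_imset _ _ (fun A => A :|: K)); last first.
  apply: (can_in_inj (g := fun S => S :\: K)) => A; rewrite !inE => /andP[AK _].
  apply/finset.setP => x; rewrite !inE; have [xK|_] /= := boolP (x \in K).
    by apply/esym/negbTE/negP => /(fintype.subsetP AK); rewrite inE xK.
  by rewrite orbF.
apply: eq_card => S; rewrite inE; apply/andP/imsetP.
  move=> [KS /eqP Ss]; exists (S :\: K).
    rewrite inE cardsD (finset.setIidPr KS) Ss eqxx andbT.
    by rewrite finset.setDE finset.subsetIr.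
  by rewrite finset.setUC -{1}(finset.setIidPr KS) finset.setID.
move=> [A]; rewrite inE => /andP[AK /eqP As] ->; split.
  exact: finset.subsetUr.
rewrite cardsU As (_ : A :&: K = finset.set0) ?cards0 ?subn0 ?subnK//.
by apply/eqP; rewrite finset.setI_eq0 finset.disjoints_subset.
Qed.

Section intersecting_sets.
Variables (d s k : nat).
Implicit Types (S K : {set 'I_d}) (D : {set {set 'I_d}}).

Lemma card_candidates : #|candidates d s| = 'C(d, s).
Proof. by rewrite card_draws card_ord. Qed.

(** The quotient of the two binomials is the product over [j < k] of [(s - j) / (d - j)], and each
    factor is at most [s / d]. *)
Lemma bin_sub_expn : (s <= d)%N -> (k <= s)%N ->
  ('C(d - k, s - k) * d ^ k <= s ^ k * 'C(d, s))%N.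
Proof.
move=> sd; elim: k => [|j IH] js; first by rewrite !subn0 !expn0 muln1 mul1n.
have jd := leq_trans js sd.
have step : ((d - j) * 'C(d - j.+1, s - j.+1) = (s - j) * 'C(d - j, s - j))%N.
  by have := mul_bin_diag (d - j) (s - j.+1); rewrite -subnS subnSK.
have ratio : ((s - j) * d <= s * (d - j))%N by nia.
have : ((d - j) * ('C(d - j.+1, s - j.+1) * d ^ j.+1) <=
        (d - j) * (s ^ j.+1 * 'C(d, s)))%N.
  rewrite mulnA step !expnS; have := IH (ltnW js).
  move: ratio; set x := 'C(_, _).
  set y := (_ ^ j)%N; set z := (_ ^ j)%N; set w := 'C(_, _).
  nia.
by rewrite leq_pmul2l// subn_gt0.
Qed.

(** Union bound over the sets [K] of [k] points in [S]: there are at most [s ^ k] of them, and each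
    lies in at most a fraction [(s / d) ^ k] of the candidates. *)
Lemma card_large_intersection S : (s <= d)%N -> #|S| = s ->
  (#|[set S' in candidates d s | (k <= #|S :&: S'|)%N]%SET| * d ^ k <=
   s ^ (k + k) * #|candidates d s|)%N.
Proof.
move=> sd Ss; have [ks|sk] := leqP k s; last first.
  rewrite (_ : [set _ in _ | _]%SET = finset.set0) ?cards0//.
  apply/finset.setP => S'; rewrite !inE; apply/negbTE/nandP; right.
  by rewrite -ltnNge (leq_ltn_trans _ sk)// -Ss subset_leq_card// finset.subsetIl.
pose Ks := [set K : {set 'I_d} | (K \subset S) && (#|K| == k)]%SET.
pose up K := [set S' : {set 'I_d} | (K \subset S') && (#|S'| == s)]%SET.
have cardU : (#|(\bigcup_(K in Ks) up K)%SET| <= 'C(s, k) * 'C(d - k, s - k))%N.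
  apply: (@leq_trans (\sum_(K in Ks) #|up K|)).
    apply: (@big_rec2 _ _ (fun (A : {set {set 'I_d}}) m => #|A| <= m)%N)
      => [|K m A _ Am].
      by rewrite cards0.
    by rewrite (leq_trans (leq_card_setU _ _))// leq_add2l.
  rewrite (eq_bigr (fun=> 'C(d - k, s - k))) => [|K].
    by rewrite sum_nat_const cards_draws Ss.
  by rewrite inE => /andP[_ /eqP Kk]; rewrite card_supersets Kk// card_ord.
have : (#|[set S' in candidates d s | (k <= #|S :&: S'|)%N]%SET| <=
    'C(s, k) * 'C(d - k, s - k))%N.
  apply: leq_trans cardU; apply: subset_leq_card; apply/fintype.subsetP => S'.
  rewrite inE => /andP[]; rewrite inE => S's kI.
  have : (0 < #|[set K : {set 'I_d} | (K \subset S :&: S') && (#|K| == k)]%SET|)%N.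
    by rewrite cards_draws bin_gt0.
  rewrite card_gt0 => /set0Pn[K].
  rewrite inE finset.subsetI => /andP[/andP[KS KS'] Kk].
  by apply/finset.bigcupP; exists K; rewrite inE ?KS ?KS' ?Kk.
move=> bad; rewrite card_candidates expnD.
apply: leq_trans (leq_mul bad (leqnn _)) _.
by rewrite -!mulnA leq_mul ?leq_bin_expn// bin_sub_expn.
Qed.

(** For fixed [S], each [S'] meeting it in fewer than [k] points contributes at most [k ^ 2]; the
    others contribute at most [s ^ 2] each and are counted among all candidates. *)
Lemma sum_sqr_card_setI D : (s <= d)%N -> D \subset candidates d s ->
  ((\sum_(S in D) \sum_(S' in D) #|S :&: S'| ^ 2) * d ^ k <=
   #|D| * (k ^ 2 * #|D| * d ^ k + s ^ 2 * (s ^ (k + k) * #|candidates d s|)))%N.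
Proof.
move=> sd DC; rewrite big_distrl /= -sum_nat_const leq_sum// => S SD.
have Ss : #|S| = s by have /(fintype.subsetP DC) := SD; rewrite inE => /eqP.
pose bad := [set S' in candidates d s | (k <= #|S :&: S'|)%N]%SET.
apply: (@leq_trans ((k ^ 2 * #|D| + s ^ 2 * #|bad|) * d ^ k)).
  rewrite leq_mul2r; apply/orP; right.
  rewrite (bigID (mem bad)) /= addnC leq_add//.
    rewrite mulnC -sum_nat_const [leqRHS](bigID (mem bad)) /= addnC.
    apply: leq_trans (leq_addr _ _); apply: leq_sum => S' /andP[S'D].
    rewrite inE (fintype.subsetP DC _ S'D) /= -ltnNge => /ltnW ?.
    by rewrite leq_exp2r.
  rewrite mulnC -sum_nat_const [leqRHS](bigID (mem D)) /=.
  apply: leq_trans (leq_addr _ _); under [leqRHS]eq_bigl do rewrite andbC.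
  apply: leq_sum => S' _; rewrite leq_exp2r// -Ss.
  by rewrite subset_leq_card// finset.subsetIl.
by rewrite mulnDl leq_add2l -mulnA leq_mul2l card_large_intersection ?orbT.
Qed.

End intersecting_sets.

(** * Asymptotics *)

Section rounded_root.
Context {R : realType}.
Variables (d s : nat).
Hypotheses (d0 : (0 < d)%N) (s8 : `|s%:R - d%:R `^ (8^-1 : R)| < (1 : R)).

Let u : R := d%:R `^ 8^-1.

Let u8 : u ^+ 8 = d%:R.
Proof. by rewrite -powR_mulrn ?powR_ge0// -powRrM mulVf// powRr1. Qed.

Let u1 : 1 <= u.
Proof.
by rewrite -(powRr0 (d%:R : R)) ler_powR// ?invr_ge0// ler1n.
Qed.

Let su : s%:R < 1 + u.
Proof. by rewrite -ltrBlDr (le_lt_trans (ler_norm _))//. Qed.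

(** Since [1 <= u], an integer at distance less than 1 from [u] is not 0, and [u <= u ^+ 8 = d%:R]
    bounds it above. *)
Lemma rounded_root_bounds : (0 < s <= d)%N.
Proof.
have ud : u <= d%:R by rewrite -u8 ler_eXnr.
apply/andP; split.
  rewrite lt0n; apply/eqP => s0; move: s8; rewrite s0 sub0r normrN -/u.
  by rewrite ger0_norm ?powR_ge0// ltNge u1.
rewrite -ltnS -(ltr_nat R) (lt_le_trans su)// -natr1 addrC lerD2r//.
Qed.

(** With [s <= 2 * u] and [d = u ^ 8], the claim is a comparison of powers of [u]:
    [8 * m + (2 * k + 2) + 8 <= 8 * k], that is [12 * m + 14 <= 16 * m + 16]. *)
Lemma rounded_root_decay (eta : R) (m k : nat) : eta <= m%:R -> k = (2 * m).+2 ->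
  d%:R `^ eta * ((s ^ (k + k).+2)%:R / (d ^ k)%:R) <= (2 ^ (k + k).+2)%:R / d%:R.
Proof.
move=> etam kE; have dR : 0 < d%:R :> R by rewrite ltr0n.
rewrite !natrX mulrA ler_pdivrMr ?exprn_gt0//.
rewrite mulrAC ler_pdivlMr//.
have s2u : s%:R <= 2 * u.
  by rewrite (le_trans (ltW su))// mulr2n mulrDl !mul1r lerD2r.
have du : d%:R `^ eta <= u ^+ (8 * m).
  by rewrite exprM u8 -powR_mulrn// ler_powR// ler1n.
apply: (@le_trans _ _ (u ^+ (8 * m) * (2 * u) ^+ (k + k).+2 * u ^+ 8)).
  rewrite u8 ler_wpM2r// ler_pM ?powR_ge0 ?exprn_ge0//.
  by rewrite lerXn2r ?nnegrE// mulr_ge0// ltW// (lt_le_trans ltr01).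
rewrite exprMn (mulrCA (u ^+ (8 * m))) -mulrA ler_wpM2l ?exprn_ge0//.
by rewrite -u8 -exprM -!exprD ler_weXn2l// kE; lia.
Qed.

End rounded_root.

(** * Bound on the detected fraction in a fixed dimension, uniform in the query *)

Section detected_card.
Context {R : realType} {d : nat}.
Variables (s n k : nat) (beta b xi : R).
Hypotheses (s0 : (0 < s)%N) (sd : (s <= d)%N) (n0 : (0 < n)%N) (b0 : 0 < b).
Hypotheses (beta0 : 0 < beta) (beta2 : beta <= 2^-1) (xi4 : 0 <= xi < 4^-1).
Variables (P0 : probability (euclid R d) R)
  (PS : {set 'I_d} -> probability (euclid R d) R).
Hypothesis P0std : is_gaussian 0 1%:M P0.
Hypothesis PSspiked : forall S, S \in candidates d s ->
  is_gaussian 0 (spiked_cov s beta S) (PS S).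
Hypothesis weak :
  (beta%:E * sqrte (n%:R%:E / ((s%:R ^+ 2)%:E * log_inv xi)) <=
   (k.+1%:R^-1)%:E)%E.

Lemma log_inv0 : log_inv (0 : R) = +oo%E.
Proof. by rewrite /log_inv inver eqxx. Qed.

Lemma log_inv_gt0 (x : R) : 0 < x -> log_inv x = (- ln x)%:E.
Proof.
by move=> x0; rewrite /log_inv inver gt_eqF// lne_EFin ?invr_gt0// lnV ?posrE.
Qed.

Lemma card_detected_expn q : q \in queries d b ->
  (#|detected s b n xi P0 PS q| * d ^ k <=
   s ^ 2 * (s ^ (k + k) * #|candidates d s|))%N.
Proof.
move=> qQ; set D := detected _ _ _ _ _ _ _.
(* At [xi = 0] the tolerance is infinite and nothing is detected. *)
have [xi0|xi_neq0] := eqVneq xi 0.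
  suff -> : D = finset.set0 by rewrite cards0.
  apply/finset.setP => S; rewrite !inE; apply/negbTE/nandP; right.
  rewrite -leNgt /tolerance xi0 log_inv0 inver pnatr_eq0 eqn0Ngt n0 /=.
  rewrite gt0_mulye ?lte_fin ?invr_gt0 ?ltr0n// gt0_muley; last first.
    by rewrite lte_fin divr_gt0// mulr_gt0.
  by rewrite maxye leey.
have {xi_neq0} xi0 : 0 < xi by rewrite lt_neqAle eq_sym xi_neq0; case/andP: xi4.
pose l := - ln xi.
have l0 : 0 < l.
  rewrite oppr_gt0 ln_lt0// xi0/=; case/andP: xi4 => _ /lt_trans; apply.
  by rewrite invf_lt1// ltr1n.
have xil := log_inv_gt0 _ xi0; rewrite -/l in xil.
have sR : 0 < s%:R :> R by rewrite ltr0n.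
have nR : 0 < n%:R :> R by rewrite ltr0n.
(* Squaring [weak] gives [(beta / s) ^ 2 <= (l / n) / (k + 1) ^ 2], and
   [k ^ 2 + 1 <= 2 * (k + 1) ^ 2]. *)
have tE : (k ^ 2).+1%:R * (beta / s%:R) ^+ 2 <= 2 * l / n%:R.
  have sl0 : 0 < s%:R ^+ 2 * l by rewrite mulr_gt0// exprn_gt0.
  have := weak; rewrite xil -EFinM inver gt_eqF//= -!EFinM lee_fin.
  set r := Num.sqrt _; have r0 : 0 <= r by exact: sqrtr_ge0.
  have r2 : r ^+ 2 = n%:R / (s%:R ^+ 2 * l) by rewrite sqr_sqrtr// divr_ge0// ltW.
  have K0 : 0 < k.+1%:R :> R by rewrite ltr0n.
  rewrite -(@ler_pXn2r _ 2) ?nnegrE ?mulr_ge0 ?invr_ge0 ?(ltW beta0)//.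
  rewrite exprMn r2 exprVn.
  rewrite (_ : beta ^+ 2 * _ = (beta / s%:R) ^+ 2 * (n%:R / l)); last first.
    by field; rewrite !gt_eqF.
  rewrite -ler_pdivlMr ?divr_gt0// invf_div => h.
  rewrite (le_trans (ler_wpM2l _ h))// [leLHS]mulrA -[leRHS]mulrA ler_wpM2r//.
    by rewrite divr_ge0// ltW.
  have kk : (k ^ 2 < 2 * k.+1 ^ 2)%N.
    by rewrite (@leq_trans (k.+1 ^ 2))// ?ltn_exp2r// leq_pmull.
  by rewrite (ler_pdivrMr _ _ (exprn_gt0 2 K0)) -natrX -natrM ler_nat.
have DC : D \subset candidates d s.
  by apply/fintype.subsetP => S; rewrite inE => /andP[].
have Dsum := sum_sqr_card_setI d s k D sd DC.
have := card_detected_sqr s beta b s0 beta0 beta2 P0 PS P0std PSspiked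
  n xi l q n0 (ltW l0) xil qQ.
rewrite -/D; set X := (\sum_(S in D) \sum_(S' in D) #|S :&: S'| ^ 2)%N in Dsum *.
have -> : \sum_(S in D) \sum_(S' in D) (beta * (#|S :&: S'|%:R / s%:R)) ^+ 2 =
    (beta / s%:R) ^+ 2 * X%:R.
  rewrite /X natr_sum mulr_sumr; apply: eq_bigr => S _.
  rewrite natr_sum mulr_sumr; apply: eq_bigr => S' _.
  by rewrite natrX -exprMn; congr (_ ^+ 2); rewrite mulrA mulrAC.
move=> DX.
have {DX} : ((k ^ 2).+1 * #|D| ^ 2 <= X)%N.
  rewrite -(ler_nat R) -(ler_pM2l (_ : 0 < (beta / s%:R) ^+ 2)); last first.
    by rewrite exprn_gt0// divr_gt0.
  apply: le_trans DX; rewrite natrM natrX mulrA mulrC.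
  by rewrite ler_wpM2l ?sqr_ge0// mulrC.
move=> DX; have [->//|D0] := posnP #|D|.
(* Of the [k ^ 2 + 1] copies of [m ^ 2 * y] on the left, [k ^ 2] cancel against the small
   intersections; dividing by [m] leaves [m * y <= z]. *)
have := leq_trans (leq_mul DX (leqnn (d ^ k))) Dsum.
set y := (d ^ k)%N; set z := (s ^ 2 * _)%N; set m := #|D| in D0 *.
rewrite -mulnA mulSn [(k ^ 2 * (_ * _))%N]mulnA.
rewrite (_ : m ^ 2 * y + k ^ 2 * m ^ 2 * y =
  m * (k ^ 2 * m * y + m * y))%N; last by ring.
by rewrite leq_pmul2l// leq_add2l.
Qed.

Lemma sup_card_detected :
  0 <= sup [set (#|detected s b n xi P0 PS q|%:R : R) | q in queries d b]
       / (#|candidates d s|)%:R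
    <= (s ^ (k + k).+2)%:R / (d ^ k)%:R.
Proof.
set A := [set _ | q in _].
have d0 : (0 < d)%N by exact: leq_trans sd.
(* The zero query shows that [A] is nonempty, so that its [sup] is a genuine supremum. *)
have Q0 : queries d b (cst 0 : euclid R d -> R).
  by split=> //= x; rewrite oppr_le0 !ltW.
have AP x : A x ->
    0 <= x <= (s ^ (k + k).+2)%:R / (d ^ k)%:R * (#|candidates d s|)%:R.
  move=> [q /mem_set qQ <-]; rewrite ler0n /=.
  rewrite mulrAC ler_pdivlMr ?ltr0n ?expn_gt0 ?d0// -!natrM ler_nat.
  by rewrite (leq_trans (card_detected_expn _ qQ))// mulnA -expnD.
have A0 : A !=set0 by eexists; exists (cst 0).
have Aub : ubound A ((s ^ (k + k).+2)%:R / (d ^ k)%:R * (#|candidates d s|)%:R).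
  by move=> x /AP/andP[].
have C0 : 0 < (#|candidates d s|)%:R :> R.
  by rewrite ltr0n card_candidates bin_gt0.
rewrite ler_pdivrMr// ge_sup// andbT divr_ge0//.
have [x Ax] := A0; have /andP[x0 _] := AP _ Ax; apply: (le_trans x0).
by apply: ub_le_sup => //; eexists; exact: Aub.
Qed.

End detected_card.

Theorem theorem6p3 (R : realType) (b eta : R)
    (s n : nat -> nat) (beta xi T : nat -> R)
    (P0 : forall d : nat, probability (euclid R d) R)
    (PS : forall d : nat, {set 'I_d} -> probability (euclid R d) R) :
  0 < b ->
  (forall d : nat, 0 < beta d) ->
  (forall d : nat, 0 <= xi d < 4^-1) ->
  (forall d : nat, 1 <= T d) ->
  (* [s d] is [d^(1/8)], rounded to an integer *)
  (forall d : nat, `|(s d)%:R - d%:R `^ (8^-1 : R)| < (1 : R)) ->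
  (forall d : nat, is_gaussian 0 1%:M (P0 d)) ->
  (forall (d : nat) (S : {set 'I_d}), S \in candidates d (s d) ->
     is_gaussian 0 (spiked_cov (s d) (beta d) S) (PS d S)) ->
  n @ \oo --> \oo ->
  beta @ \oo --> (0 : R) ->
  (T : nat -> R^o) =O_\oo (fun d : nat => d%:R `^ eta : R^o) ->
  ((beta d)%:E * sqrte ((n d)%:R%:E / (((s d)%:R ^+ 2)%:E * log_inv (xi d))))%E
    @[d --> \oo] --> (0 : \bar R)%E ->
  T d * sup [set (#|detected (s d) b (n d) (xi d) (P0 d) (PS d) q|)%:R
               | q in queries d b]
    / (#|candidates d (s d)|)%:R @[d --> \oo] --> (0 : R).
Proof.
move=> b0 beta0 xi4 T1 s8 P0std PSspiked noo beta_cvg TO weak.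
have [M M0 TM] : exists2 M : R, 0 < M & \forall d \near \oo, T d <= M * d%:R `^ eta.
  have /eqO_exP[M M0 TM] := TO; exists M => //; near=> d.
  rewrite (le_trans (ler_norm _))// -[X in _ * X]ger0_norm ?powR_ge0//.
  by near: d.
(* The absolute value allows for a negative [eta]; this [k] is the one for which
   [rounded_root_decay] leaves a spare factor [d^-1]. *)
pose m := Num.bound `|eta|; pose k := (2 * m).+2.
have etam : eta <= m%:R.
  by rewrite (le_trans (ler_norm _))// ltW// archi_boundP.
pose C : R := M * (2 ^ (k + k).+2)%:R.
have k0 : ((0 : R)%:E < (k.+1%:R^-1)%:E)%E by rewrite lte_fin invr_gt0 ltr0n.
(* Eventually the ratio is at most [M * d ^ eta * s ^ (2 * k + 2) / d ^ k], hence at most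
   [C / d]. *)
apply: (@squeeze_cvgr _ _ _ _ (cst 0) (fun d => C / d%:R)).
- near=> d.
  have d1 : (0 < d)%N by near: d; exact: nbhs_infty_gt.
  have n0 : (0 < n d)%N by near: d; exact: (noo _ (nbhs_infty_gt 0)).
  have beta2 : beta d <= 2^-1.
    by near: d; apply: (cvgr_le _ beta_cvg); rewrite invr_gt0.
  have weakd : ((beta d)%:E * sqrte ((n d)%:R%:E /
      (((s d)%:R ^+ 2)%:E * log_inv (xi d))) <= (k.+1%:R^-1)%:E)%E.
    by apply/ltW; near: d; exact: (weak _ (open_ereal_lt' k0)).
  have TMd : T d <= M * d%:R `^ eta by near: d.
  have /andP[s0 sd] := rounded_root_bounds _ _ d1 (s8 d).
  have /andP[D0 DC] := sup_card_detected _ _ _ _ _ _ s0 sd n0 b0 (beta0 d) beta2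
    (xi4 d) (P0 d) (PS d) (P0std d) (PSspiked d) weakd.
  apply/andP; split; rewrite -mulrA.
    by rewrite mulr_ge0// (le_trans ler01).
  apply: (le_trans (ler_pM _ D0 TMd DC)); first by rewrite (le_trans ler01).
  rewrite /C -!mulrA ler_pM2l//.
  exact: (rounded_root_decay _ _ d1 (s8 d) _ m).
- exact: cvg_cst.
rewrite -(mulr0 C); apply: cvgMl_tmp.
apply/gtr0_cvgV0; last exact: cvgr_idn.
by near=> d; rewrite ltr0n; near: d; exact: nbhs_infty_gt.
Unshelve. all: by end_near.
Qed.
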